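(* Let $\mathbf{A}=\mathbf{T}\boldsymbol{\Lambda}\mathbf{T}^{-1}\in\mathbb{R}^{N_h\times N_h}$ be a diagonalizable matrix, where $\boldsymbol{\Lambda}=\mathrm{diag}(\lambda_1,\dots,\lambda_{N_h})\in\mathbb{C}^{N_h\times N_h}$ contains the eigenvalues and $\mathbf{T}\in\mathbb{C}^{N_h\times N_h}$ is an invertible matrix of eigenvectors, and suppose that $\Re\{\lambda_i\}<0$ for all $i=1,\dots,N_h$. Let $\mu_{\min}:=\min_i|\Re\{\lambda_i\}|$ and $\mu_{\max}:=\max_i|\lambda_i|$. Let $\Delta t>0$ and let $\{\mathbf{u}_n\}_{n\ge0}$ be an IMEX--RB sequence with timestep $\Delta t$ for the problem $\mathbf{y}'=\mathbf{A}\mathbf{y}$, $\mathbf{y}(0)=\mathbf{y}_0$. Suppose that at each timestep $t_n$ the reduced basis matrix $\mathbf{V}_n$ satisfies $$\bigl\|(\mathbf{I}-\mathbf{V}_n\mathbf{V}_n^{T})\mathbf{u}_{n+1}\bigr\|\le\varepsilon\,\|\mathbf{u}_{n+1}\|,$$ where $\varepsilon$ is such that $$0\le\varepsilon<\frac{\mu_{\min}}{\mu_{\max}K_2(\mathbf{T})}\le1,$$ with $K_2(\mathbf{T})=\|\mathbf{T}\|\,\|\mathbf{T}^{-1}\|$ the condition number of $\mathbf{T}$ in the spectral norm. Then the IMEX--RB scheme is absolutely stable, i.e. $$\lim_{n\to+\infty}\|\mathbf{u}_{n+1}\|=0.$$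
   Context: $N_h\in\mathbb{N}$, $\mathbf{y}_0\in\mathbb{R}^{N_h}$, $\|\cdot\|$ is the Euclidean norm on vectors and the spectral norm on matrices, and $\mathbf{I}$ is the identity matrix. An IMEX--RB sequence with timestep $\Delta t$ for $\mathbf{y}'=\mathbf{A}\mathbf{y}$, $\mathbf{y}(0)=\mathbf{y}_0$, is a sequence $\{\mathbf{u}_n\}_{n\ge0}\subset\mathbb{R}^{N_h}$ with $\mathbf{u}_0=\mathbf{y}_0$ such that for all $n\ge0$ $$\mathbf{u}_{n+1}=\mathbf{u}_n+\Delta t\,\mathbf{A}\mathbf{V}_n\mathbf{V}_n^{T}\mathbf{u}_{n+1},$$ where $\mathbf{V}_n$ is a real matrix with $N_h$ rows and orthonormal columns (the number $N$ of columns may depend on $n$) whose column space contains $\mathbf{u}_n$. (Equivalently: solve $\boldsymbol{\delta u}^N_{n+1}=\Delta t\,\mathbf{V}_n^{T}\mathbf{A}(\mathbf{V}_n\boldsymbol{\delta u}^N_{n+1}+\mathbf{u}_n)$ for $\boldsymbol{\delta u}^N_{n+1}\in\mathbb{R}^N$, then set $\mathbf{u}_{n+1}=\mathbf{u}_n+\Delta t\,\mathbf{A}(\mathbf{V}_n\boldsymbol{\delta u}^N_{n+1}+\mathbf{u}_n)$.) The timesteps are $t_n=n\Delta t$, and $\varepsilon$ does not depend on $n$. *)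

(* Defs.v *)
From mathcomp Require Import all_boot all_order all_algebra.
From mathcomp Require Import all_classical all_reals all_analysis.
From mathcomp Require Import complex.

Set Implicit Arguments.
Unset Strict Implicit.
Unset Printing Implicit Defensive.
Import Order.TTheory GRing.Theory Num.Theory.
Import numFieldNormedType.Exports.
Local Open Scope classical_set_scope.
Local Open Scope ring_scope.

Definition toC {R : realType} (x : R) : R[i] := x%:C%C.

(* The norm the library puts on matrices is the sup norm, and the generic norm on
   R[i] takes values in R[i]; hence the norms below, with values in R, where
   Normc.normc is the modulus. *)
Definition norm2 {R : realType} (m : nat) (x : 'cV[R]_m) : R :=
  Num.sqrt (\sum_i x i 0 ^+ 2).

Definition cnorm2 {R : realType} (m : nat) (x : 'cV[R[i]]_m) : R :=
  Num.sqrt (\sum_i Normc.normc (x i 0) ^+ 2).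

Definition spectral_norm {R : realType} (m p : nat) (M : 'M[R[i]]_(m, p)) : R :=
  sup [set cnorm2 (M *m x) | x in [set x : 'cV[R[i]]_p | cnorm2 x = 1]].

Definition cond2 {R : realType} (m : nat) (T : 'M[R[i]]_m) : R :=
  spectral_norm T * spectral_norm (invmx T).

(* The dimension is a successor so that the minimum and maximum range over a
   nonempty set; the value at index ord0 only initializes the iteration. *)
Definition mu_min {R : realType} (d : nat) (lambda : 'rV[R[i]]_d.+1) : R :=
  \big[Num.min/`|complex.Re (lambda 0 ord0)|]_i `|complex.Re (lambda 0 i)|.

Definition mu_max {R : realType} (d : nat) (lambda : 'rV[R[i]]_d.+1) : R :=
  \big[Num.max/Normc.normc (lambda 0 ord0)]_i Normc.normc (lambda 0 i).

(* V n has N n columns.  Since submx compares row spaces, the second clause says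
   that u n lies in the column space of V n. *)
Definition imex_rb {R : realType} (m : nat) (A : 'M[R]_m) (y0 : 'cV[R]_m)
    (dt : R) (N : nat -> nat) (V : forall n, 'M[R]_(m, N n))
    (u : nat -> 'cV[R]_m) : Prop :=
  u 0%N = y0 /\
  forall n, [/\ (V n)^T *m V n = 1%:M,
                ((u n)^T <= (V n)^T)%MS &
                u n.+1 = u n + dt *: (A *m V n *m (V n)^T *m u n.+1)].

(* Main.v *)
Require Import Defs.
From mathcomp Require Import all_boot all_order all_algebra.
From mathcomp Require Import all_classical all_reals all_analysis.
From mathcomp Require Import complex.
From mathcomp Require Import ring lra.

Set Implicit Arguments.
Unset Strict Implicit.
Unset Printing Implicit Defensive.
Import Order.TTheory GRing.Theory Num.Theory.
Import numFieldNormedType.Exports.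
Local Open Scope classical_set_scope.
Local Open Scope ring_scope.

(** In the variable [w n := T^-1 *m u n] one step of the scheme is a strict
    contraction by a factor that does not depend on [n].

    Let [r n := (1 - V n *m (V n)^T) *m u n.+1] be the projection error. The
    scheme reads [u n.+1 = u n + dt A u n.+1 - dt A (r n)], that is, implicit Euler
    with a perturbation; in the eigenbasis,
    [(1 - dt Lambda) (w n.+1) = w n - dt Lambda T^-1 (r n)].
    Each diagonal entry on the left has modulus at least [1 + dt mu_min], because
    the eigenvalues lie in the open left half-plane
    ([cnorm2_implicit_step_ge]). The perturbation is bounded by
    [dt mu_max |T^-1| eps |u n.+1| <= dt mu_max cond2 T eps |w n.+1|]. Hence
    ([imex_rb_step_contraction])
    [(1 + dt (mu_min - mu_max cond2 T eps)) |w n.+1| <= |w n|],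
    and the upper bound on [eps] says that the factor on the left exceeds [1]. So
    [|w n|], and with it [|u n| <= |T| |w n|], decays geometrically.

    The bound [mu_min / (mu_max cond2 T) <= 1] holds because
    [|Re z| <= |z|] and [1 = |T T^-1| <= cond2 T]. *)

(** * The modulus and the Euclidean norm *)

Lemma normc_ge0 (R : realType) (z : R[i]) : 0 <= Normc.normc z.
Proof. by case: z => a b; exact: sqrtr_ge0. Qed.

Lemma Re_le_normc (R : realType) (z : R[i]) :
  `|complex.Re z| <= Normc.normc z.
Proof.
case: z => a b /=; rewrite -(sqrtr_sqr a).
by apply: ler_wsqrtr; rewrite lerDl sqr_ge0.
Qed.

Lemma normc_toC (R : realType) (x : R) : Normc.normc (toC x) = `|x|.
Proof. by rewrite /toC /= expr0n addr0 sqrtr_sqr. Qed.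

(** The square roots are cleared by expanding
    [0 <= \sum_i (|b| * a i - |a| * b i) ^+ 2 = 2 |a| |b| (|a| |b| - a . b)];
    the factor [|a| |b|] can be cancelled unless one of the vectors is zero. *)
Lemma sum_cauchy_schwarz (R : realType) (I : finType) (a b : I -> R) :
  \sum_i a i * b i <=
  Num.sqrt (\sum_i a i ^+ 2) * Num.sqrt (\sum_i b i ^+ 2).
Proof.
have sq_ge0 (c : I -> R) : 0 <= \sum_i c i ^+ 2.
  by apply: sumr_ge0 => i _; exact: sqr_ge0.
have sq_eq0 (c : I -> R) : Num.sqrt (\sum_i c i ^+ 2) = 0 -> forall i, c i = 0.
  move=> /eqP; rewrite sqrtr_eq0 => c_le0 i.
  have /eqP : \sum_i c i ^+ 2 = 0 by apply/le_anti; rewrite c_le0 sq_ge0.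
  rewrite psumr_eq0 => [/allP /(_ i (mem_index_enum i))|j _].
    by rewrite /= sqrf_eq0 => /eqP.
  exact: sqr_ge0.
set X := Num.sqrt (\sum_i a i ^+ 2); set Y := Num.sqrt (\sum_i b i ^+ 2).
have X2 : \sum_i a i ^+ 2 = X ^+ 2 by rewrite sqr_sqrtr.
have Y2 : \sum_i b i ^+ 2 = Y ^+ 2 by rewrite sqr_sqrtr.
have [X0|X0] := eqVneq X 0.
  rewrite X0 mul0r big1// => i _; by rewrite (sq_eq0 a X0) mul0r.
have [Y0|Y0] := eqVneq Y 0.
  rewrite Y0 mulr0 big1// => i _; by rewrite (sq_eq0 b Y0) mulr0.
have XY_gt0 : 0 < X * Y by rewrite mulr_gt0// lt0r ?X0 ?Y0 sqrtr_ge0.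
have : 0 <= \sum_i (Y * a i - X * b i) ^+ 2 by exact: sq_ge0.
have -> : \sum_i (Y * a i - X * b i) ^+ 2 =
    (X * Y) * (2 * (X * Y - \sum_i a i * b i)).
  transitivity (\sum_i (Y ^+ 2 * a i ^+ 2 - 2 * X * Y * (a i * b i)
                        + X ^+ 2 * b i ^+ 2)).
    by apply: eq_bigr => i _; ring.
  by rewrite big_split sumrB /= -!mulr_sumr X2 Y2; ring.
by rewrite pmulr_rge0// pmulr_rge0// subr_ge0.
Qed.

Section EuclideanNorm.
Variables (R : realType) (m : nat).
Implicit Types (x y : 'cV[R[i]]_m).

Lemma cnorm2_ge0 x : 0 <= cnorm2 x.
Proof. exact: sqrtr_ge0. Qed.

Lemma cnorm2_sqr x : cnorm2 x ^+ 2 = \sum_i Normc.normc (x i 0) ^+ 2.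
Proof. by rewrite sqr_sqrtr// sumr_ge0// => i _; exact: sqr_ge0. Qed.

Lemma cnorm2N x : cnorm2 (- x) = cnorm2 x.
Proof.
congr Num.sqrt; apply: eq_bigr => i _.
by rewrite mxE (normcN (x i 0 : Rcomplex R)).
Qed.

Lemma cnorm2_mono x y :
  (forall i, Normc.normc (x i 0) <= Normc.normc (y i 0)) ->
  cnorm2 x <= cnorm2 y.
Proof.
move=> le_xy; apply/ler_wsqrtr/ler_sum => i _.
by rewrite ler_sqr ?nnegrE ?normc_ge0.
Qed.

Lemma cnorm2Z (c : R[i]) x : cnorm2 (c *: x) = Normc.normc c * cnorm2 x.
Proof.
rewrite /cnorm2 -[X in _ = X * _](ger0_norm (normc_ge0 c)) -sqrtr_sqr -sqrtrM ?sqr_ge0//.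
rewrite mulr_sumr; congr Num.sqrt; apply: eq_bigr => i _.
by rewrite mxE Normc.normcM exprMn.
Qed.

Lemma cnorm20 : cnorm2 (0 : 'cV[R[i]]_m) = 0.
Proof. by rewrite -(scale0r (0 : 'cV_m)) cnorm2Z Normc.normc0; exact: mul0r. Qed.

Lemma cnorm2_eq0 x : (cnorm2 x == 0) = (x == 0).
Proof.
apply/eqP/eqP => [x0|->]; last exact: cnorm20.
apply/matrixP => i j; rewrite ord1 [RHS]mxE.
have /eqP : \sum_i Normc.normc (x i 0) ^+ 2 = 0 by rewrite -cnorm2_sqr x0 expr0n.
rewrite psumr_eq0 => [/allP /(_ i (mem_index_enum i))|k _]; last exact: sqr_ge0.
by rewrite /= sqrf_eq0 => /eqP /Normc.eq0_normc.
Qed.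

Lemma cnorm2D x y : cnorm2 (x + y) <= cnorm2 x + cnorm2 y.
Proof.
rewrite -ler_sqr ?nnegrE ?addr_ge0 ?cnorm2_ge0// cnorm2_sqr.
apply: (@le_trans _ _
  (\sum_i (Normc.normc (x i 0) + Normc.normc (y i 0)) ^+ 2)).
  apply: ler_sum => i _; rewrite mxE ler_sqr ?nnegrE ?addr_ge0 ?normc_ge0//.
  exact: le_normcD.
under eq_bigr do rewrite sqrrD.
rewrite !big_split/= -!cnorm2_sqr sqrrD lerD2r lerD2l -mulr2n lerMn2r/=.
exact: sum_cauchy_schwarz.
Qed.

Lemma normc_le_cnorm2 x i : Normc.normc (x i 0) <= cnorm2 x.
Proof.
rewrite -ler_sqr ?nnegrE ?normc_ge0 ?cnorm2_ge0// cnorm2_sqr (bigD1 i)//=.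
by rewrite lerDl sumr_ge0// => j _; exact: sqr_ge0.
Qed.

Lemma cnorm2_map_toC (v : 'cV[R]_m) : cnorm2 (map_mx toC v) = norm2 v.
Proof.
congr Num.sqrt; apply: eq_bigr => i _.
by rewrite mxE normc_toC real_normK ?num_real.
Qed.

End EuclideanNorm.

(** * The spectral norm and the condition number *)

(** The supremum of a set without upper bound is a junk value, so boundedness
    must be known first. A crude constant suffices: each entry of [M *m x] is at
    most the sum of the moduli in its row when [x] is a unit vector. *)
Lemma spectral_norm_has_ubound (R : realType) (m p : nat)
    (M : 'M[R[i]]_(m, p)) :
  has_ubound [set cnorm2 (M *m x) | x in [set x : 'cV[R[i]]_p | cnorm2 x = 1]].
Proof.
pose C i : R := \sum_j Normc.normc (M i j).
exists (Num.sqrt (\sum_i C i ^+ 2)) => _ [x /= x1 <-].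
have C_ge0 i : 0 <= C i by apply: sumr_ge0 => j _; exact: normc_ge0.
apply/ler_wsqrtr/ler_sum => i _.
rewrite ler_sqr ?nnegrE ?normc_ge0// mxE.
have normc_sum (F : 'I_p -> R[i]) :
    Normc.normc (\sum_j F j) <= \sum_j Normc.normc (F j).
  elim/big_rec2: _ => [|j b a _ le_ab]; first by rewrite Normc.normc0.
  exact: le_trans (le_normcD _ _) (lerD (lexx _) le_ab).
apply: le_trans (normc_sum _) _; apply: ler_sum => j _.
rewrite Normc.normcM ler_piMr ?normc_ge0//.
by rewrite -x1 normc_le_cnorm2.
Qed.

Lemma spectral_norm_ge0 (R : realType) (m p : nat) (M : 'M[R[i]]_(m, p)) :
  0 <= spectral_norm M.
Proof.
(* For [p = 0] there is no unit vector, and the supremum of the empty set is 0. *)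
rewrite /spectral_norm; set E := (X in sup X).
have [->|/set0P[y [x x1 _]]] := eqVneq E set0; first by rewrite sup0.
apply: le_trans (cnorm2_ge0 (M *m x)) _.
by apply: ub_le_sup; [exact: spectral_norm_has_ubound | exists x].
Qed.

Lemma cnorm2_mulmx_le (R : realType) (m p : nat) (M : 'M[R[i]]_(m, p))
    (x : 'cV[R[i]]_p) :
  cnorm2 (M *m x) <= spectral_norm M * cnorm2 x.
Proof.
have [->|x0] := eqVneq x 0.
  by rewrite mulmx0 !cnorm20 mulr0.
(* Normalize [x]: the supremum ranges over unit vectors only. *)
have nx : cnorm2 x != 0 by rewrite cnorm2_eq0.
have nx_gt0 : 0 < cnorm2 x by rewrite lt0r nx cnorm2_ge0.
have normK : Normc.normc (toC (cnorm2 x)^-1) = (cnorm2 x)^-1.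
  by rewrite normc_toC ger0_norm// invr_ge0 cnorm2_ge0.
rewrite -ler_pdivrMr// mulrC -normK -cnorm2Z scalemxAr.
apply: ub_le_sup; first exact: spectral_norm_has_ubound.
by exists (toC (cnorm2 x)^-1 *: x) => //=; rewrite cnorm2Z normK mulVf.
Qed.

(** Any nonzero [x] satisfies
    [|x| = |T (T^-1 x)| <= |T| |T^-1| |x|]. *)
Lemma cond2_ge1 (R : realType) (d : nat) (T : 'M[R[i]]_d.+1) :
  T \in unitmx -> 1 <= cond2 T.
Proof.
move=> Tu; pose x : 'cV[R[i]]_d.+1 := const_mx 1.
have x_gt0 : 0 < cnorm2 x.
  rewrite lt0r cnorm2_ge0 andbT cnorm2_eq0; apply/eqP => /matrixP /(_ ord0 0).
  by rewrite !mxE => /eqP; rewrite oner_eq0.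
rewrite -(ler_pM2r x_gt0) mul1r -{1}(mulKVmx Tu x) -mulrA.
apply: le_trans (cnorm2_mulmx_le _ _) _.
by rewrite ler_wpM2l ?spectral_norm_ge0// cnorm2_mulmx_le.
Qed.

(** * Spectral bounds and diagonal matrices *)

Section Spectrum.
Variables (R : realType) (d : nat) (lambda : 'rV[R[i]]_d.+1).

Lemma mu_min_gt0 : (forall i, complex.Re (lambda 0 i) < 0) -> 0 < mu_min lambda.
Proof.
move=> Re_lt0; have abs_gt0 i : 0 < `|complex.Re (lambda 0 i)|.
  by rewrite normr_gt0 lt_eqF.
by apply: lt_bigmin => [|i _]; exact: abs_gt0.
Qed.

Lemma mu_min_le i : mu_min lambda <= `|complex.Re (lambda 0 i)|.
Proof. exact: bigmin_le. Qed.

Lemma le_mu_max i : Normc.normc (lambda 0 i) <= mu_max lambda.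
Proof. exact: (le_bigmax _ (fun i => Normc.normc (lambda 0 i))). Qed.

Lemma mu_min_le_mu_max : mu_min lambda <= mu_max lambda.
Proof.
exact: le_trans (mu_min_le ord0) (le_trans (Re_le_normc _) (le_mu_max ord0)).
Qed.

Lemma cnorm2_diag_le (x : 'cV[R[i]]_d.+1) :
  cnorm2 (diag_mx lambda *m x) <= mu_max lambda * cnorm2 x.
Proof.
have mu_ge0 : 0 <= mu_max lambda := le_trans (normc_ge0 _) (le_mu_max ord0).
rewrite -[X in X * _](ger0_norm mu_ge0) -normc_toC -cnorm2Z.
apply: cnorm2_mono => i; rewrite mul_diag_mx !mxE !Normc.normcM.
by rewrite ler_wpM2r ?normc_ge0// normc_toC ger0_norm ?le_mu_max.
Qed.

(** Since the spectrum is in the left half-plane, [1 - dt * lambda i] has real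
    part [1 + dt * |Re (lambda i)|]: this is where the implicit step expands, for
    every [dt]. *)
Lemma cnorm2_implicit_step_ge (dt : R) (w : 'cV[R[i]]_d.+1) :
  (forall i, complex.Re (lambda 0 i) < 0) -> 0 < dt ->
  (1 + dt * mu_min lambda) * cnorm2 w <=
  cnorm2 (w - toC dt *: (diag_mx lambda *m w)).
Proof.
move=> Re_lt0 dt_gt0; have mu_gt0 := mu_min_gt0 Re_lt0.
have c_ge0 : 0 <= 1 + dt * mu_min lambda.
  by rewrite addr_ge0// mulr_ge0// ltW.
rewrite -[X in X * _](ger0_norm c_ge0) -normc_toC -cnorm2Z.
apply: cnorm2_mono => i; rewrite mul_diag_mx !mxE.
have -> : w i 0 - toC dt * (lambda 0 i * w i 0) =
  (1 - toC dt * lambda 0 i) * w i 0 by ring.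
rewrite !Normc.normcM ler_wpM2r ?normc_ge0// normc_toC ger0_norm//.
apply: le_trans (Re_le_normc _); apply: le_trans (ler_norm _).
have := mu_min_le i; rewrite ltr0_norm ?Re_lt0// => mu_le.
case: (lambda 0 i) mu_le => a b /= mu_le.
have : dt * mu_min lambda <= dt * - a by rewrite ler_pM2l.
lra.
Qed.

End Spectrum.

(** * Stability *)

(** The change of basis is paid for twice, by [|T^-1|] on the projection error
    and by [|T|] when its relative bound is read on [u' = T (T^-1 u')]; this is
    how [cond2 T] enters. *)
Lemma imex_rb_step_contraction (R : realType) (d k : nat) (A : 'M[R]_d.+1)
    (T : 'M[R[i]]_d.+1) (lambda : 'rV[R[i]]_d.+1) (dt eps : R)
    (V : 'M[R]_(d.+1, k)) (u u' : 'cV[R]_d.+1) :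
  T \in unitmx ->
  map_mx toC A = T *m diag_mx lambda *m invmx T ->
  (forall i, complex.Re (lambda 0 i) < 0) -> 0 < dt -> 0 <= eps ->
  u' = u + dt *: (A *m V *m V^T *m u') ->
  norm2 ((1%:M - V *m V^T) *m u') <= eps * norm2 u' ->
  (1 + dt * (mu_min lambda - mu_max lambda * cond2 T * eps)) *
    cnorm2 (invmx T *m map_mx toC u') <= cnorm2 (invmx T *m map_mx toC u).
Proof.
move=> Tu A_diag Re_lt0 dt_gt0 eps_ge0 u'E err_le.
pose r := (1%:M - V *m V^T) *m u'.
pose w := invmx T *m map_mx toC u; pose w' := invmx T *m map_mx toC u'.
pose s := invmx T *m map_mx toC r.
have u_eq : u = u' - dt *: (A *m u') + dt *: (A *m r).
  rewrite /r mulmxBl mul1mx mulmxBr scalerBr !mulmxA addrA subrK {1}u'E.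
  by rewrite addrK.
have w_eq : w = (w' - toC dt *: (diag_mx lambda *m w'))
                + toC dt *: (diag_mx lambda *m s).
  (* [map_mx toC] only meets the morphism lemmas once [toC] is seen as the
     canonical embedding [real_complex R]. *)
  have mapA (x : 'cV[R]_d.+1) : invmx T *m map_mx toC (A *m x) =
      diag_mx lambda *m (invmx T *m map_mx toC x).
    rewrite (map_mxM (real_complex R)) [map_mx _ A]A_diag.
    by rewrite !mulmxA mulVmx// mul1mx.
  rewrite /w u_eq (map_mxD (real_complex R)) (map_mxB (real_complex R)).
  rewrite !(map_mxZ (real_complex R)) mulmxDr mulmxBr -!scalemxAr.
  by rewrite !mapA.
have mu_ge0 : 0 <= mu_max lambda.
  exact: le_trans (normc_ge0 _) (le_mu_max lambda ord0).
have u'_le : norm2 u' <= spectral_norm T * cnorm2 w'.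
  by rewrite -cnorm2_map_toC -{1}(mulKVmx Tu (map_mx toC u')) cnorm2_mulmx_le.
have s_le : cnorm2 s <= cond2 T * eps * cnorm2 w'.
  apply: le_trans (cnorm2_mulmx_le _ _) _; rewrite cnorm2_map_toC.
  have -> : cond2 T * eps * cnorm2 w' = spectral_norm (invmx T) *
      (eps * (spectral_norm T * cnorm2 w')) by rewrite /cond2; ring.
  apply: ler_wpM2l; first exact: spectral_norm_ge0.
  by apply: le_trans err_le _; exact: ler_wpM2l.
have pert_le : cnorm2 (toC dt *: (diag_mx lambda *m s)) <=
    dt * (mu_max lambda * (cond2 T * eps * cnorm2 w')).
  rewrite cnorm2Z normc_toC gtr0_norm// ler_pM2l//.
  by apply: le_trans (cnorm2_diag_le _ _) _; exact: ler_wpM2l.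
have step_le : cnorm2 (w' - toC dt *: (diag_mx lambda *m w')) <=
    cnorm2 w + cnorm2 (toC dt *: (diag_mx lambda *m s)).
  rewrite -(addrK (toC dt *: (diag_mx lambda *m s)) (w' - _)) -w_eq.
  by rewrite -(cnorm2N (toC dt *: _)) cnorm2D.
have -> : (1 + dt * (mu_min lambda - mu_max lambda * cond2 T * eps)) * cnorm2 w' =
    (1 + dt * mu_min lambda) * cnorm2 w' -
    dt * (mu_max lambda * (cond2 T * eps * cnorm2 w')) by ring.
rewrite lerBlDr; apply: le_trans (cnorm2_implicit_step_ge w' Re_lt0 dt_gt0) _.
by apply: le_trans step_le _; rewrite lerD2l.
Qed.

Theorem theorem2p6 (R : realType) (d : nat) (A : 'M[R]_d.+1)
    (T : 'M[R[i]]_d.+1) (lambda : 'rV[R[i]]_d.+1) (y0 : 'cV[R]_d.+1)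
    (dt eps : R) (N : nat -> nat) (V : forall n, 'M[R]_(d.+1, N n))
    (u : nat -> 'cV[R]_d.+1)
    (T_unit : T \in unitmx)
    (A_diag : map_mx toC A = T *m diag_mx lambda *m invmx T)
    (Re_lt0 : forall i, complex.Re (lambda 0 i) < 0)
    (dt_gt0 : 0 < dt)
    (u_imex : imex_rb A y0 dt V u)
    (V_eps : forall n,
      norm2 ((1%:M - V n *m (V n)^T) *m u n.+1) <= eps * norm2 (u n.+1))
    (eps_ge0 : 0 <= eps)
    (eps_lt : eps < mu_min lambda / (mu_max lambda * cond2 T)) :
  mu_min lambda / (mu_max lambda * cond2 T) <= 1 /\
  norm2 (u n.+1) @[n --> \oo] --> (0 : R).
Proof.
have mu_gt0 := mu_min_gt0 Re_lt0.
have mu_le := mu_min_le_mu_max lambda.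
have max_gt0 : 0 < mu_max lambda := lt_le_trans mu_gt0 mu_le.
have K_ge1 := cond2_ge1 T_unit.
have maxK_gt0 : 0 < mu_max lambda * cond2 T.
  by rewrite mulr_gt0// (lt_le_trans ltr01).
split.
  rewrite ler_pdivrMr// mul1r (le_trans mu_le)//.
  by rewrite ler_peMr// ltW.
pose gap := mu_min lambda - mu_max lambda * cond2 T * eps.
have gap_gt0 : 0 < gap.
  by move: eps_lt; rewrite ltr_pdivlMr// subr_gt0 mulrC.
pose rho := 1 + dt * gap.
have rho_gt1 : 1 < rho by rewrite ltrDl mulr_gt0.
have rho_gt0 : 0 < rho := lt_trans ltr01 rho_gt1.
pose w n := invmx T *m map_mx toC (u n).
have w_step n : cnorm2 (w n.+1) <= rho^-1 * cnorm2 (w n).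
  have [_ _ uE] := u_imex.2 n.
  rewrite mulrC ler_pdivlMr// mulrC.
  exact: imex_rb_step_contraction T_unit A_diag Re_lt0 dt_gt0 eps_ge0 uE (V_eps n).
have w_le n : cnorm2 (w n) <= rho^-1 ^+ n * cnorm2 (w 0%N).
  elim: n => [|n IHn]; first by rewrite expr0 mul1r.
  rewrite exprS -mulrA; apply: le_trans (w_step n) _.
  by rewrite ler_pM2l ?invr_gt0.
have u_le n : norm2 (u n) <= geometric (spectral_norm T * cnorm2 (w 0%N)) rho^-1 n.
  rewrite -cnorm2_map_toC -(mulKVmx T_unit (map_mx toC (u n))) /=.
  apply: le_trans (cnorm2_mulmx_le _ _) _.
  by rewrite -mulrA ler_wpM2l ?spectral_norm_ge0// mulrC w_le.
have u_cvg : norm2 (u n) @[n --> \oo] --> (0 : R).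
  have rho_lt1 : `|rho^-1| < 1 by rewrite gtr0_norm ?invr_gt0// invf_lt1.
  apply: (squeeze_cvgr _ (cvg_cst (0 : R))
    (cvg_geometric (spectral_norm T * cnorm2 (w 0%N)) rho_lt1)).
  by apply: nearW => n; apply/andP; split; [exact: sqrtr_ge0 | exact: u_le].
by move: u_cvg; rewrite -(cvg_shiftS (fun n => norm2 (u n))).
Qed.
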